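(* Let $X$ be a set, let $G=F(Y)$ be the group built from $X$ in the context, with its two binary operations $\cdot$ and $:$, and let $\sim$ be the equivalence relation on $G$ defined in the context. Then the group $G/\!\sim$, endowed with the binary operations $\cdot$ and $:$ induced by the corresponding operations of $G$, is the free skew-brace over $X$. That is, $G/\!\sim$ with these operations is a skew-brace and, denoting by $i\colon X\to G/\!\sim$ the canonical map (sending $x\in X$ to the class of the one-letter word $x$), for every skew-brace $A$ and every map $f\colon X\to A$ there is a unique skew-brace morphism $\varphi\colon G/\!\sim\;\to A$ such that $f=\varphi\circ i$.
   Context: **Skew-braces.** A skew-brace is taken here in the following (equivalent) form: a group $(A,\circ)$, with product written $ab=a\circ b$, endowed with two left actions $b\mapsto a\cdot b$ and $b\mapsto a:b$ of the group $A$ on the underlying set of $A$, such that $(a\cdot b)a=(b:a)b$ for all $a,b\in A$. A morphism of skew-braces is a group homomorphism $\varphi$ with $\varphi(a\cdot b)=\varphi(a)\cdot\varphi(b)$ and $\varphi(a:b)=\varphi(a):\varphi(b)$ for all $a,b$. **The set $Y$.** Let $X$ be a set. Define recursively an increasing sequence of sets $Y_1\subseteq Y_2\subseteq\cdots$, each with a fixed-point-free involution $a\mapsto a^*$ (so $(a^* )^*=a$). First, $Y_1=X\sqcup X^*$, where $X^*=\{x^*: x\in X\}$ is a disjoint copy of $X$. For $n\ge 2$, let $$X_n^{\cdot}=\{a\cdot b \mid a,b\in Y_{n-1},\ b\neq a^*\cdot c\text{ for any } c\in Y_{n-1}\},$$ $$X_n^{:}=\{a:b \mid a,b\in Y_{n-1},\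 b\neq a^*: c\text{ for any } c\in Y_{n-1}\},$$ where $a\cdot b$ and $a:b$ are formal symbols (the condition $b\ne a^*\cdot c$ means that $b$ is not the formal symbol $a^*\cdot c$, and likewise for $:$). Then $Y_n$ is obtained from $Y_{n-1}$ by adjoining the formal symbols in $X_n^{\cdot}\sqcup X_n^{:}$ and a disjoint copy $(X_n^{\cdot}\sqcup X_n^{:})^*$ of starred symbols. A symbol $a\cdot b$ or $a:b$ (or its starred version) that already belongs to $Y_{n-1}$ is identified with the one there. Set $Y=\bigcup_{n\ge1}Y_n$. **The group $G$.** $G=F(Y)$ is the free group whose underlying set is the set of reduced words in the alphabet $Y$, where $x^*$ plays the role of the inverse of $x$. That is, words are reduced when they contain no two consecutive letters $x,x^*$ with $x\in Y$, and multiplication is concatenation followed by reduction. The empty word is $1$. **The operations on $Y$.** Define maps $\cdot$ and $:$ from $Y\times Y$ to $Y$ as follows. If $b$ is the formal symbol $a^*\cdot c$ for some $c\in Y$, then $a\cdot b=c$; otherwise $a\cdot b$ is the formal symbol $a\cdot b$. If $b$ is the formal symbol $a^*:c$ for some $c\in Y$, then $a:b=c$; otherwise $a:b$ is the formal symbol $a:b$. **Extension to $G$.** Extend these to maps $Y\times G\to G$, recursively on the length of the reduced word in the second argument, by $x\cdot 1=x:1=1$ and $$x\cdot(gy)=((y:x)\cdot g)(x\cdot y),\qquad x:(gy)=((y\cdot x):g)(x:y)$$ for $x,y\in Y$ and each reduced word $gy$ with last letter $y$. Then extend to binary operations on $G$ by $1\cdot g=1:g=g$ and $$(x_1x_2\cdots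 x_n)\cdot g=x_1\cdot(x_2\cdot(\cdots(x_n\cdot g)\cdots)),\qquad (x_1x_2\cdots x_n):g=x_1:(x_2:(\cdots(x_n:g)\cdots))$$ for each reduced word $x_1x_2\cdots x_n$ with $x_i\in Y$ and each $g\in G$. **The relation $\sim$.** Let $\sim$ be the minimal equivalence relation on $G$ such that: (1) $(x\cdot y)x\sim(y:x)y$ for all $x,y\in Y$; (2) if $a\sim b$ and $c\sim d$, then $ac\sim bd$, $a\cdot c\sim b\cdot d$ and $a:c\sim b:d$. *)

(* Defs.v *)
From HB Require Import structures.
From mathcomp Require Import all_boot all_classical.

Set Implicit Arguments.
Unset Strict Implicit.
Unset Printing Implicit Defensive.

Local Open Scope classical_set_scope.
Local Open Scope quotient_scope.
Local Open Scope group_scope.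

Definition is_left_action (A : groupType) (T : Type) (act : A -> T -> T) : Prop :=
  (forall t, act 1 t = t) /\ (forall a b t, act (a * b) t = act a (act b t)).

Record is_skew_brace (A : groupType) (dot col : A -> A -> A) : Prop :=
  IsSkewBrace {
    dot_left_action : is_left_action dot;
    col_left_action : is_left_action col;
    dot_col_compat : forall a b, dot a b * a = col b a * b
  }.

Record is_skew_brace_morphism (A B : groupType) (dotA colA : A -> A -> A)
    (dotB colB : B -> B -> B) (phi : A -> B) : Prop :=
  IsSkewBraceMorphism {
    morph_group : monoid_morphism phi;
    morph_dot : {morph phi : a b / dotA a b >-> dotB a b};
    morph_col : {morph phi : a b / colA a b >-> colB a b}
  }.

(* Formal symbols, before imposing any membership condition.  The boolean of a
   constructor tells whether the symbol carries an outermost star: for instance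
   [Dot true a b] is the symbol (a . b)^*. *)
Inductive symbol (X : Type) : Type :=
| Gen of bool & X
| Dot of bool & symbol X & symbol X
| Col of bool & symbol X & symbol X.

HB.instance Definition _ (X : Type) := gen_eqMixin (symbol X).
HB.instance Definition _ (X : Type) := gen_choiceMixin (symbol X).

Section Alphabet.
Variable X : Type.
Implicit Types (a b c t : symbol X) (S : set (symbol X)) (m n : nat).

Definition star_symbol t : symbol X :=
  match t with
  | Gen s x => Gen (~~ s) x
  | Dot s a b => Dot (~~ s) a b
  | Col s a b => Col (~~ s) a b
  end.

Definition new_dots S : set (symbol X) :=
  [set t | exists a b, [/\ S a, S b,
     forall c, S c -> b <> Dot false (star_symbol a) c & t = Dot false a b]].

Definition new_cols S : set (symbol X) :=
  [set t | exists a b, [/\ S a, S b,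
     forall c, S c -> b <> Col false (star_symbol a) c & t = Col false a b]].

(* [Y_stage n] is Y_(n+1), so that [Y_stage 0] is X together with X^*. *)
Fixpoint Y_stage n : set (symbol X) :=
  if n is m.+1 then
    let S := Y_stage m in
    let N := new_dots S `|` new_cols S in
    S `|` (N `|` star_symbol @` N)
  else [set t | exists s x, t = Gen s x].

Definition Y_set : set (symbol X) := \bigcup_n Y_stage n.

(* When b lies in Y and is the symbol a^* . c, c lies in Y by [Y_set_Dot_arg]
   below, so that membership of c need not be tested; the same holds for [Col]. *)
Definition dot_symbol a b : symbol X :=
  if b is Dot false a' c then
    if a' == star_symbol a then c else Dot false a b
  else Dot false a b.

Definition col_symbol a b : symbol X :=
  if b is Col false a' c then
    if a' == star_symbol a then c else Col false a b
  else Col false a b.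

Lemma star_symbolK : involutive star_symbol.
Proof. by case=> s *; rewrite /= negbK. Qed.

Lemma Y_stageS n : Y_stage n `<=` Y_stage n.+1.
Proof. by move=> t; left. Qed.

Lemma Y_stage_mono m n : m <= n -> Y_stage m `<=` Y_stage n.
Proof.
elim: n => [|n IHn]; first by rewrite leqn0 => /eqP->.
rewrite leq_eqVlt ltnS => /predU1P[->//|/IHn lemn].
exact: subset_trans lemn (@Y_stageS n).
Qed.

Lemma Y_set_star t : Y_set t -> Y_set (star_symbol t).
Proof.
move=> [n _ tn]; exists n => //; elim: n t tn => [|n IHn] t /=.
  by move=> [s [x ->]]; exists (~~ s), x.
move=> [/IHn|]; first by left.
move=> [Nt|[u Nu <-]]; right; first by right; exists t.
by left; rewrite star_symbolK.
Qed.

Lemma Y_set_Dot_arg s a b : Y_set (Dot s a b) -> Y_set b.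
Proof.
move=> [n _]; elim: n => [[? [? //]]|n IHn] /=.
move=> [/IHn//|[[]|[u []]]].
- by move=> [a' [b' [_ Yb' _ [_ _ ->]]]]; exists n.
- by move=> [a' [b' [_ _ _ //]]].
- by move=> [a' [b' [_ Yb' _ ->]]] /= [_ _ <-]; exists n.
- by move=> [a' [b' [_ _ _ -> //]]].
Qed.

Lemma Y_set_Col_arg s a b : Y_set (Col s a b) -> Y_set b.
Proof.
move=> [n _]; elim: n => [[? [? //]]|n IHn] /=.
move=> [/IHn//|[[]|[u []]]].
- by move=> [a' [b' [_ _ _ //]]].
- by move=> [a' [b' [_ Yb' _ [_ _ ->]]]]; exists n.
- by move=> [a' [b' [_ _ _ -> //]]].
- by move=> [a' [b' [_ Yb' _ ->]]] /= [_ _ <-]; exists n.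
Qed.

Lemma Y_set_Dot a b : Y_set a -> Y_set b ->
  (forall c, b <> Dot false (star_symbol a) c) -> Y_set (Dot false a b).
Proof.
move=> [m _ Ya] [n _ Yb] bN; exists (maxn m n).+1 => //; right; left; left.
exists a, b; split=> //; [exact: Y_stage_mono (leq_maxl m n) _ Ya|].
exact: Y_stage_mono (leq_maxr m n) _ Yb.
Qed.

Lemma Y_set_Col a b : Y_set a -> Y_set b ->
  (forall c, b <> Col false (star_symbol a) c) -> Y_set (Col false a b).
Proof.
move=> [m _ Ya] [n _ Yb] bN; exists (maxn m n).+1 => //; right; left; right.
exists a, b; split=> //; [exact: Y_stage_mono (leq_maxl m n) _ Ya|].
exact: Y_stage_mono (leq_maxr m n) _ Yb.
Qed.

Lemma Y_set_dot_symbol a b : Y_set a -> Y_set b -> Y_set (dot_symbol a b).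
Proof.
move=> Ya; case: b => [s x|[] b1 b2|s b1 b2] Yb /=; try exact: Y_set_Dot.
case: eqP => [_|neq]; first exact: Y_set_Dot_arg Yb.
by apply: Y_set_Dot => // c [].
Qed.

Lemma Y_set_col_symbol a b : Y_set a -> Y_set b -> Y_set (col_symbol a b).
Proof.
move=> Ya; case: b => [s x|s b1 b2|[] b1 b2] Yb /=; try exact: Y_set_Col.
case: eqP => [_|neq]; first exact: Y_set_Col_arg Yb.
by apply: Y_set_Col => // c [].
Qed.

Lemma Y_set_Gen s (x : X) : Y_set (Gen s x).
Proof. by exists 0 => //; exists s, x. Qed.

Definition Y : Type := set_type Y_set.

HB.instance Definition _ := SubChoice.copy Y {t | t \in Y_set}.

Implicit Types x y : Y.

Definition starY x : Y := SigSub (mem_set (Y_set_star (set_mem (valP x)))).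

Definition dotY x y : Y :=
  SigSub (mem_set (Y_set_dot_symbol (set_mem (valP x)) (set_mem (valP y)))).

Definition colY x y : Y :=
  SigSub (mem_set (Y_set_col_symbol (set_mem (valP x)) (set_mem (valP y)))).

Definition genY (x : X) : Y := SigSub (mem_set (Y_set_Gen false x)).

Lemma starYK : involutive starY.
Proof. by move=> x; apply: val_inj; rewrite /= star_symbolK. Qed.

End Alphabet.

Section FreeGroup.
Variable X : Type.
Notation Y := (Y X).
Implicit Types (x y : Y) (u v w : seq Y).

Definition reduced w : bool := sorted (fun x y => y != starY x) w.

Definition push x w : seq Y :=
  if w is y :: w' then if y == starY x then w' else x :: w else [:: x].

Definition reduce w : seq Y := foldr push [::] w.

Lemma reduced_push x w : reduced w -> reduced (push x w).
Proof.
case: w => [//|y w] /=; case: eqP => [_|/eqP yNx] yw; first exact: path_sorted yw.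
by rewrite /reduced /= yNx.
Qed.

Lemma reduced_foldr_push u w : reduced w -> reduced (foldr push w u).
Proof. by move=> rw; elim: u => //= x u; apply: reduced_push. Qed.

Lemma reduced_reduce w : reduced (reduce w).
Proof. exact: reduced_foldr_push. Qed.

Lemma reduce_id w : reduced w -> reduce w = w.
Proof.
elim: w => //= x w IHw rxw; rewrite IHw; last exact: path_sorted rxw.
by case: w rxw {IHw} => //= y w /andP[/negPf->].
Qed.

Lemma pushK x w : reduced w -> push (starY x) (push x w) = w.
Proof.
case: w => [|y w] /=; first by rewrite starYK eqxx.
case: eqP => [->|_] rw /=; last by rewrite starYK eqxx.
by case: w rw => //= z w /andP[/negPf->].
Qed.

Lemma foldr_push_push x u w : reduced w ->
  foldr push w (push x u) = push x (foldr push w u).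
Proof.
move=> rw; case: u => //= y u; case: eqP => //= ->.
by rewrite -{1}[x]starYK pushK // reduced_foldr_push.
Qed.

Lemma foldr_push_reduce u w : reduced w ->
  foldr push w (reduce u) = foldr push w u.
Proof. by move=> rw; elim: u => //= x u IHu; rewrite foldr_push_push // IHu. Qed.

Lemma reduce_cat u v : reduced v -> reduce (u ++ v) = foldr push v u.
Proof. by move=> rv; rewrite /reduce foldr_cat -/(reduce v) reduce_id. Qed.

Lemma reduced_rev_star w : reduced w -> reduced (rev (map (@starY X) w)).
Proof.
rewrite /reduced rev_sorted sorted_map; apply: sub_sorted => x y /=.
by apply: contraNneq => ->; rewrite !starYK.
Qed.

Record freeY : Type := Word { letters :> seq Y; _ : reduced letters }.

HB.instance Definition _ := [isSub for letters].
HB.instance Definition _ := [Choice of freeY by <:].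

Implicit Types g h k : freeY.

Lemma freeYP g : reduced g. Proof. exact: (valP g). Qed.

Definition freeY_one : freeY := @Word [::] isT.
Definition freeY_mul g h : freeY := Word (reduced_reduce (letters g ++ letters h)).
Definition freeY_inv g : freeY := Word (reduced_rev_star (freeYP g)).

Lemma freeY_mulA : associative freeY_mul.
Proof.
move=> g h k; apply: val_inj => /=; rewrite reduce_cat ?reduced_reduce //.
rewrite !reduce_cat ?freeYP //.
by rewrite -(reduce_cat g (freeYP h)) foldr_push_reduce ?freeYP ?foldr_cat.
Qed.

Lemma freeY_mul1g : left_id freeY_one freeY_mul.
Proof. by move=> g; apply: val_inj; rewrite /= reduce_id ?freeYP. Qed.

Lemma freeY_mulg1 : right_id freeY_one freeY_mul.
Proof. by move=> g; apply: val_inj; rewrite /= cats0 reduce_id ?freeYP. Qed.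

Lemma freeY_mulVg : left_inverse freeY_one freeY_inv freeY_mul.
Proof.
move=> g; apply: val_inj; rewrite /= /reduce foldr_cat.
suff K u w : reduced w ->
    foldr push (foldr push w u) (rev (map (@starY X) u)) = w by rewrite K.
move=> rw; elim: u => //= x u IHu.
by rewrite rev_cons foldr_rcons pushK // reduced_foldr_push.
Qed.

Lemma freeY_mulgV : right_inverse freeY_one freeY_inv freeY_mul.
Proof.
move=> g; have invK : freeY_inv (freeY_inv g) = g.
  by apply: val_inj; rewrite /= map_rev revK mapK //; apply: starYK.
by rewrite -{1}invK freeY_mulVg.
Qed.

HB.instance Definition _ := isGroup.Build freeY
  freeY_mulA freeY_mul1g freeY_mulg1 freeY_mulVg freeY_mulgV.

Definition letter x : freeY := @Word [:: x] isT.

(* The recursions consume the last letter of a word, i.e., the head of the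
   reversed word. *)
Fixpoint dot_letter_rev x w : freeY :=
  if w is y :: w' then dot_letter_rev (colY y x) w' * letter (dotY x y) else 1.

Fixpoint col_letter_rev x w : freeY :=
  if w is y :: w' then col_letter_rev (dotY y x) w' * letter (colY x y) else 1.

Definition dot_letter x g : freeY := dot_letter_rev x (rev g).
Definition col_letter x g : freeY := col_letter_rev x (rev g).

Definition dotG g h : freeY := foldr dot_letter h (letters g).
Definition colG g h : freeY := foldr col_letter h (letters g).

Inductive sim : freeY -> freeY -> Prop :=
| sim_refl g : sim g g
| sim_sym g h : sim g h -> sim h g
| sim_trans g h k : sim g h -> sim h k -> sim g k
| sim_base x y : sim (letter (dotY x y) * letter x) (letter (colY y x) * letter y)
| sim_mul a b c d : sim a b -> sim c d -> sim (a * c) (b * d)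
| sim_dot a b c d : sim a b -> sim c d -> sim (dotG a c) (dotG b d)
| sim_col a b c d : sim a b -> sim c d -> sim (colG a c) (colG b d).

Lemma sim_inv g h : sim g h -> sim g^-1 h^-1.
Proof.
move=> gh; have := sim_mul (sim_mul (sim_refl g^-1) (sim_sym gh)) (sim_refl h^-1).
by rewrite mulVg mul1g -mulgA mulgV mulg1.
Qed.

Definition simb g h : bool := `[< sim g h >].

Lemma simb_refl : reflexive simb.
Proof. by move=> g; apply/asboolP/sim_refl. Qed.

Lemma simb_sym : symmetric simb.
Proof. by move=> g h; apply/asboolP/asboolP => /sim_sym. Qed.

Lemma simb_trans : transitive simb.
Proof.
by move=> h g k /asboolP gh /asboolP hk; apply/asboolP/(sim_trans gh hk).
Qed.

Canonical sim_equiv := EquivRel simb simb_refl simb_sym simb_trans.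

Definition quoG : Type := {eq_quot sim_equiv}.

HB.instance Definition _ := Choice.on quoG.
HB.instance Definition _ := EqQuotient.on quoG.

Lemma quoG_eqP g h : \pi_quoG g = \pi_quoG h <-> sim g h.
Proof. by split=> [/eqmodP/asboolP|gh]; last exact/eqmodP/asboolP. Qed.

Lemma sim_repr g : sim (repr (\pi_quoG g)) g.
Proof. by apply/quoG_eqP; rewrite reprK. Qed.

Definition quo_one : quoG := \pi_quoG 1.
Definition quo_inv : quoG -> quoG := lift_op1 quoG (fun g => g^-1).
Definition quo_mul : quoG -> quoG -> quoG := lift_op2 quoG (fun g h => g * h).
Definition quo_dot : quoG -> quoG -> quoG := lift_op2 quoG dotG.
Definition quo_col : quoG -> quoG -> quoG := lift_op2 quoG colG.

Lemma pi_quo_inv : {morph \pi_quoG : g / g^-1 >-> quo_inv g}.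
Proof.
by move=> g; unlock quo_inv; apply/quoG_eqP/sim_inv/sim_sym/sim_repr.
Qed.

Lemma pi_quo_mul : {morph \pi_quoG : g h / g * h >-> quo_mul g h}.
Proof.
by move=> g h; unlock quo_mul; apply/quoG_eqP/sim_mul; apply/sim_sym/sim_repr.
Qed.

Lemma pi_quo_dot : {morph \pi_quoG : g h / dotG g h >-> quo_dot g h}.
Proof.
by move=> g h; unlock quo_dot; apply/quoG_eqP/sim_dot; apply/sim_sym/sim_repr.
Qed.

Lemma pi_quo_col : {morph \pi_quoG : g h / colG g h >-> quo_col g h}.
Proof.
by move=> g h; unlock quo_col; apply/quoG_eqP/sim_col; apply/sim_sym/sim_repr.
Qed.

Lemma quo_mulA : associative quo_mul.
Proof.
by elim/quotW=> g; elim/quotW=> h; elim/quotW=> k; rewrite -!pi_quo_mul mulgA.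
Qed.

Lemma quo_mul1g : left_id quo_one quo_mul.
Proof. by elim/quotW=> g; rewrite -pi_quo_mul mul1g. Qed.

Lemma quo_mulg1 : right_id quo_one quo_mul.
Proof. by elim/quotW=> g; rewrite -pi_quo_mul mulg1. Qed.

Lemma quo_mulVg : left_inverse quo_one quo_inv quo_mul.
Proof. by elim/quotW=> g; rewrite -pi_quo_inv -pi_quo_mul mulVg. Qed.

Lemma quo_mulgV : right_inverse quo_one quo_inv quo_mul.
Proof. by elim/quotW=> g; rewrite -pi_quo_inv -pi_quo_mul mulgV. Qed.

HB.instance Definition _ := isGroup.Build quoG
  quo_mulA quo_mul1g quo_mulg1 quo_mulVg quo_mulgV.

Definition quo_gen (x : X) : quoG := \pi_quoG (letter (genY x)).

End FreeGroup.

(* Main.v *)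
Require Import Defs.
From mathcomp Require Import all_boot all_classical.

Set Implicit Arguments.
Unset Strict Implicit.
Unset Printing Implicit Defensive.

Local Open Scope classical_set_scope.
Local Open Scope quotient_scope.
Local Open Scope group_scope.

(** In a skew-brace the compatibility (a.b)a = (b:a)b together with the two
    action laws forces a.(bc) = ((c:a).b)(a.c): multiply both sides by a and
    move a across b and then across c.  So the recursion that extends the
    operations from letters to words is the only possible one, and evaluating
    symbols in a skew-brace A, where a formal symbol a.b is read as the operation
    of A applied to the values and a star as the inverse, respects the
    operations of the free group.
    The resulting map respects each clause defining the congruence, which gives
    existence of the morphism; it is unique because every letter is obtained
    from the generators by the operations and inverses ([morphism_letter]).

    The substance is that the quotient Q is a skew-brace.  In the free
    group nothing ensures that the operations are actions, or that the recursion
    on words gives the same value on a word and on its reduction.  In Q both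
    hold, for the following reasons.

    - On letters, x.(x^*.y) = y already holds as symbols, because a symbol x^*.c
      can lie in Y only when c is not of the form x.d ([dotYK], [colYK]).
    - Combined with the relation (x.y)x = (y:x)y this shows that applying the
      recursion to y y^* produces 1 and leaves the acting letter unchanged, so
      that in Q the recursion may be run on any word, reduced or not
      ([braided_cancel], [word_act_cancel]).
    - Hence x.(qy) = ((y:x).q)(x.y) in Q for every q in Q and all letters x, y.
      Since x.q depends on x through its class only, induction on q gives
      x^-1.(x.q) = q ([letter_rule_inv]): the words act, i.e., the operations of
      Q are left actions of Q.
    - Knowing both actions, the formula p.(qr) = ((r:p).q)(p.r) extends from
      letters to all of Q ([lettered_colM]); the compatibility then follows by
      writing both arguments as products of letters ([lettered_skew_brace]).

    The exchange of . and : preserves all the hypotheses, so that the abstract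
    lemmas are proved for one operation and used for both. *)

(** * Identities in a skew-brace *)

Lemma is_skew_brace_swap (A : groupType) (dot col : A -> A -> A) :
  is_skew_brace dot col -> is_skew_brace col dot.
Proof. by case=> dotA colA compat; split. Qed.

(** The rule by which the operations are extended to words, here a consequence
    of the axioms. *)
Lemma skew_brace_dotM (A : groupType) (dot col : A -> A -> A) :
  is_skew_brace dot col ->
  forall a b c, dot a (b * c) = dot (col c a) b * dot a c.
Proof.
case=> [[dot1 dotM] [col1 colM] compat] a b c.
by apply: (mulIg a); rewrite compat colM mulgA -compat -!mulgA compat.
Qed.

Lemma skew_brace_dot1 (A : groupType) (dot col : A -> A -> A) :
  is_skew_brace dot col -> forall a, dot a 1 = 1.
Proof.
case=> [_ [col1 _] compat] a.
by apply: (mulIg a); rewrite compat col1 mulg1 mul1g.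
Qed.

(** * Groups generated by letters that act on one another *)

Section LetterCalculus.

Variables (Q : groupType) (Y : Type) (star : Y -> Y) (l : Y -> Q).
Hypothesis starK : involutive star.
Hypothesis l_star : forall x, l (star x) = (l x)^-1.
Hypothesis l_gen : forall q, exists w, q = \prod_(x <- w) l x.

Implicit Types (x y z : Y) (w u v : seq Y) (p q r : Q).
Implicit Types (dL cL : Y -> Y -> Y) (dot col : Q -> Q -> Q).

Lemma gen_indl (P : Q -> Prop) :
  P 1 -> (forall x q, P q -> P (l x * q)) -> forall q, P q.
Proof.
move=> P1 PM q; have [w ->] := l_gen q.
by elim: w => [|x w IHw]; rewrite ?big_nil ?big_cons //; apply: PM.
Qed.

Lemma gen_indr (P : Q -> Prop) :
  P 1 -> (forall q x, P q -> P (q * l x)) -> forall q, P q.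
Proof.
move=> P1 PM q; have [w ->] := l_gen q.
elim/last_ind: w => [|w x IHw]; first by rewrite big_nil.
by rewrite -cats1 big_cat big_seq1 /=; apply: PM.
Qed.

(** What survives in the quotient of the letter operations: [dL] and [cL] stand
    for . and : on letters, and only the compatibility is read through [l]. *)
Record braided dL cL : Prop := Braided {
  braided_dotK : forall x y, dL x (dL (star x) y) = y;
  braided_colK : forall x y, cL x (cL (star x) y) = y;
  braidedE : forall x y, l (dL x y) * l x = l (cL y x) * l y
}.

Lemma braided_swap dL cL : braided dL cL -> braided cL dL.
Proof. by case=> dK cK E; split=> // x y; rewrite E. Qed.

(** The extension of a letter operation to words, with values in [Q].  The word
    is given reversed, as the recursion consumes its last letter. *)
Fixpoint word_act dL cL x w : Q :=
  if w is y :: w' then word_act dL cL (cL y x) w' * l (dL x y) else 1.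

(** This is the image of x.(y^* y) after the two letters have been consumed.
    Multiply by x on the right: moving x across y turns it into y:x, moving it
    on across y^* turns it back into x, and what remains is x y^* y = x. *)
Lemma braided_cancel dL cL x y : braided dL cL ->
  l (dL (cL y x) (star y)) * l (dL x y) = 1.
Proof.
move=> [_ cK E]; apply: (mulIg (l x)).
by rewrite -mulgA E mulgA E -{2}[y]starK cK l_star mulgVK mul1g.
Qed.

Lemma word_act_cancel dL cL x z u v : braided dL cL ->
  word_act dL cL x (u ++ [:: star z, z & v]) = word_act dL cL x (u ++ v).
Proof.
move=> br; elim: u x => [|y u IHu] x /=; last by rewrite IHu.
have := braided_cancel x (star z) br; rewrite starK -mulgA => ->.
by rewrite (braided_colK br) mulg1.
Qed.

(** The word recursion read inside [Q], where it constrains the action of a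
    letter on every element and no longer on chosen words. *)
Record letter_rule dL cL dot : Prop := LetterRule {
  letter_rule1 : forall x, dot (l x) 1 = 1;
  letter_ruleM : forall x q y,
    dot (l x) (q * l y) = dot (l (cL y x)) q * l (dL x y)
}.

(** Agreement with the recursion on words that may not be reduced is essential:
    appending a letter to a reduced word may destroy reducedness. *)
Lemma word_act_letter_rule dL cL dot :
  (forall x w, dot (l x) (\prod_(y <- w) l y) = word_act dL cL x (rev w)) ->
  letter_rule dL cL dot.
Proof.
move=> dotE; split=> [x|x q y]; first by have := dotE x [::]; rewrite big_nil.
have [w ->] := l_gen q; have := dotE x (rcons w y).
by rewrite -cats1 big_cat big_seq1 cats1 rev_rcons => -> /=; rewrite dotE.
Qed.

Lemma letter_rule_letter dL cL dot x y : letter_rule dL cL dot ->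
  dot (l x) (l y) = l (dL x y).
Proof.
by case=> r1 rM; rewrite -[in LHS](mul1g (l y)) rM r1 mul1g.
Qed.

(** Induction on [q], last letter first.  The letter acting on the remaining
    prefix becomes (x.y):x^* on top of y:x, and the compatibility shows that the
    former is the inverse of the latter in [Q]; since [dot] only sees classes,
    the induction hypothesis applies to y:x. *)
Lemma letter_rule_inv dL cL dot x q : braided dL cL -> letter_rule dL cL dot ->
  dot (l x)^-1 (dot (l x) q) = q.
Proof.
move=> br lr; elim/gen_indr: q x => [|q y IHq] x.
  by rewrite (letter_rule1 lr) -l_star (letter_rule1 lr).
rewrite (letter_ruleM lr) -l_star (letter_ruleM lr).
have -> : dL (star x) (dL x y) = y.
  by rewrite -{2}[x]starK (braided_dotK br).
suff -> : l (cL (dL x y) (star x)) = (l (cL y x))^-1 by rewrite IHq.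
apply: (mulIg (l (dL x y))); rewrite -(braidedE br).
rewrite -{2}[x]starK (braided_dotK br) l_star.
by apply: (mulgI (l (cL y x))); rewrite mulVKg mulgA -(braidedE br) mulgK.
Qed.

Record lettered_actions dL cL dot col : Prop := LetteredActions {
  la_braided : braided dL cL;
  la_dot_rule : letter_rule dL cL dot;
  la_col_rule : letter_rule cL dL col;
  la_dot : is_left_action dot;
  la_col : is_left_action col
}.

Lemma lettered_actions_swap dL cL dot col :
  lettered_actions dL cL dot col -> lettered_actions cL dL col dot.
Proof. by case=> /braided_swap. Qed.

(** Peel the letters of [r] off from the right, so that only [letter_ruleM] and
    the action law of [col] are needed. *)
Lemma dot_letterM dL cL dot col x q r : lettered_actions dL cL dot col ->
  dot (l x) (q * r) = dot (col r (l x)) q * dot (l x) r.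
Proof.
case=> _ dr cr _ [col1 colM].
elim/gen_indr: r x => [|r y IHr] x.
  by rewrite mulg1 col1 (letter_rule1 dr) mulg1.
rewrite mulgA !(letter_ruleM dr) IHr colM (letter_rule_letter _ _ cr).
by rewrite mulgA.
Qed.

(** The passage from [col] to [dot] at a fixed [r]: the induction on [q] consumes
    the hypothesis with one letter of [q] at a time. *)
Lemma colM_dotM dL cL dot col r : lettered_actions dL cL dot col ->
  (forall p q, col r (p * q) = col (dot q r) p * col r q) ->
  forall p q, dot q (p * r) = dot (col r q) p * dot q r.
Proof.
move=> la colrM p; case: (la) => _ _ _ [dot1 dotM] _.
elim/gen_indl => [|x q IHq].
  (* The hypothesis at p = q = 1 makes col r 1 idempotent. *)
  have -> : col r 1 = 1.
    by apply: (mulgI (col r 1)); rewrite -{1}[r]dot1 -colrM !mulg1.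
  by rewrite !dot1.
by rewrite dotM IHq (dot_letterM _ _ _ la) -dotM -colrM -dotM.
Qed.

Lemma lettered_dot1 dL cL dot col q : lettered_actions dL cL dot col ->
  dot q 1 = 1.
Proof.
case=> _ dr _ [dot1 dotM] _.
by elim/gen_indl: q => // x q IHq; rewrite dotM IHq (letter_rule1 dr).
Qed.

(** Induction on the acting element.  Passing from [r] to y r needs the dual
    formula, but only with [r] as last factor; [colM_dotM] derives it from the
    induction hypothesis, which avoids a circular mutual induction. *)
Lemma lettered_colM dL cL dot col : lettered_actions dL cL dot col ->
  forall r p q, col r (p * q) = col (dot q r) p * col r q.
Proof.
move=> la; case: (la) => _ _ _ _ [col1 colM].
elim/gen_indl => [|y r IHr] p q.
  by rewrite (lettered_dot1 _ la) !col1.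
rewrite (colM_dotM la IHr) !colM IHr.
by rewrite (dot_letterM _ _ _ (lettered_actions_swap la)).
Qed.

Lemma lettered_skew_brace dL cL dot col :
  lettered_actions dL cL dot col -> is_skew_brace dot col.
Proof.
move=> la; case: (la) => br dr cr [dot1 dotM] [col1 colM]; split=> //.
have colD := lettered_colM la.
have compat_l x q : dot (l x) q * l x = col q (l x) * q.
  elim/gen_indr: q x => [|q y IHq] x.
    by rewrite (letter_rule1 dr) col1 mulg1 mul1g.
  rewrite (letter_ruleM dr) -mulgA (braidedE br) mulgA IHq.
  by rewrite colM (letter_rule_letter _ _ cr) mulgA.
move=> p q; elim/gen_indl: p q => [|x p IHp] q.
  by rewrite dot1 (lettered_dot1 _ (lettered_actions_swap la)) mulg1 mul1g.
by rewrite dotM mulgA compat_l -mulgA IHp mulgA colD.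
Qed.

End LetterCalculus.

(** * Symbols of the alphabet *)

Section Symbols.
Variable X : Type.
Implicit Types (a b c t : symbol X).

(** A symbol Dot s a b enters Y only through [new_dots], whose side condition
    quantifies over c in the current stage.  When b = a^*.c is in that stage, so
    is c by induction; hence the condition excludes every c. *)
Lemma Y_stage_Dot n s a b : Y_stage n (Dot s a b) ->
  [/\ Y_stage n a, Y_stage n b & forall c, b <> Dot false (star_symbol a) c].
Proof.
elim: n s a b => [|n IHn] s a b /=; first by case=> ? [].
case=> [/IHn[Ya Yb bN]|Nab]; first by split=> //; left.
have {Nab s} : new_dots (Y_stage n) (Dot false a b).
  case: Nab => [[[a' [b' [Ya Yb bN [_ -> ->]]]]|[? [? [_ _ _]]]]|] //.
    by exists a', b'.
  case=> t [] [a' [b' [Ya Yb bN ->]]] //= [_ <- <-].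
  by exists a', b'.
move=> [a' [b' [Ya Yb bN [-> ->]]]]; split; [by left|by left|].
move=> c bE; have := Yb; rewrite bE => /IHn[_ Yc _].
exact: bN bE.
Qed.

Lemma Y_stage_Col n s a b : Y_stage n (Col s a b) ->
  [/\ Y_stage n a, Y_stage n b & forall c, b <> Col false (star_symbol a) c].
Proof.
elim: n s a b => [|n IHn] s a b /=; first by case=> ? [].
case=> [/IHn[Ya Yb bN]|Nab]; first by split=> //; left.
have {Nab s} : new_cols (Y_stage n) (Col false a b).
  case: Nab => [[[? [? [_ _ _]]]|[a' [b' [Ya Yb bN [_ -> ->]]]]]|] //.
    by exists a', b'.
  case=> t [] [a' [b' [Ya Yb bN ->]]] //= [_ <- <-].
  by exists a', b'.
move=> [a' [b' [Ya Yb bN [-> ->]]]]; split; [by left|by left|].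
move=> c bE; have := Yb; rewrite bE => /IHn[_ Yc _].
exact: bN bE.
Qed.

Lemma dot_symbol_formal a b : (forall c, b <> Dot false (star_symbol a) c) ->
  dot_symbol a b = Dot false a b.
Proof.
by case: b => // -[] // a' c bN /=; case: eqP => // eq; case: (bN c); rewrite eq.
Qed.

Lemma col_symbol_formal a b : (forall c, b <> Col false (star_symbol a) c) ->
  col_symbol a b = Col false a b.
Proof.
by case: b => // -[] // a' c bN /=; case: eqP => // eq; case: (bN c); rewrite eq.
Qed.

Lemma dot_symbolP a b :
  (exists2 c, b = Dot false (star_symbol a) c & dot_symbol a b = c) \/
  (forall c, b <> Dot false (star_symbol a) c) /\ dot_symbol a b = Dot false a b.
Proof.
have [[c bE]|bN] := pselect (exists c, b = Dot false (star_symbol a) c).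
  by left; exists c; rewrite ?bE //= eqxx.
by right; split; last apply: dot_symbol_formal; move=> c bE; apply: bN; exists c.
Qed.

Lemma col_symbolP a b :
  (exists2 c, b = Col false (star_symbol a) c & col_symbol a b = c) \/
  (forall c, b <> Col false (star_symbol a) c) /\ col_symbol a b = Col false a b.
Proof.
have [[c bE]|bN] := pselect (exists c, b = Col false (star_symbol a) c).
  by left; exists c; rewrite ?bE //= eqxx.
by right; split; last apply: col_symbol_formal; move=> c bE; apply: bN; exists c.
Qed.

(** When b = a.c, the inner operation cancels to c, and it must be checked that
    the outer one does not cancel again: c = a^*.d is ruled out by b being in Y. *)
Lemma dot_symbolK a b : Y_set b -> dot_symbol a (dot_symbol (star_symbol a) b) = b.
Proof.
move=> [n _ Yb]; have [[c bE ->]|[bN ->]] := dot_symbolP (star_symbol a) b.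
  rewrite star_symbolK in bE; rewrite bE dot_symbol_formal //.
  by move: Yb; rewrite bE => /Y_stage_Dot[].
by rewrite /= eqxx.
Qed.

Lemma col_symbolK a b : Y_set b -> col_symbol a (col_symbol (star_symbol a) b) = b.
Proof.
move=> [n _ Yb]; have [[c bE ->]|[bN ->]] := col_symbolP (star_symbol a) b.
  rewrite star_symbolK in bE; rewrite bE col_symbol_formal //.
  by move: Yb; rewrite bE => /Y_stage_Col[].
by rewrite /= eqxx.
Qed.

Lemma dotYK (x y : Y X) : dotY x (dotY (starY x) y) = y.
Proof. by apply: val_inj => /=; apply: dot_symbolK; apply: set_mem (valP y). Qed.

Lemma colYK (x y : Y X) : colY x (colY (starY x) y) = y.
Proof. by apply: val_inj => /=; apply: col_symbolK; apply: set_mem (valP y). Qed.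

End Symbols.

(** * Evaluating words of the free group *)

Section FreeGroupEval.
Variable X : Type.
Local Notation Y := (Y X).
Implicit Types (x y : Y) (u v w : seq Y) (g h : freeY X).

Lemma letter_star x : letter (starY x) = (letter x)^-1.
Proof. exact: val_inj. Qed.

(** The prefix [u] is quantified in the hypothesis because reduction also cancels
    pairs in the middle of a word. *)
Lemma reduce_invariant (T : Type) (f : seq Y -> T) :
  (forall u x w, f (u ++ [:: x, starY x & w]) = f (u ++ w)) ->
  forall w, f (reduce w) = f w.
Proof.
move=> fE w; rewrite -[LHS]/(f ([::] ++ reduce w)) -[RHS]/(f ([::] ++ w)).
elim: w [::] => //= x w IHw u.
rewrite -[in RHS]cat_rcons -IHw cat_rcons.
by case: (reduce w) => //= y v; case: eqP => // ->; rewrite fE.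
Qed.

Lemma prod_reduce (A : groupType) (f : Y -> A) w :
  (forall x, f (starY x) = (f x)^-1) ->
  \prod_(x <- reduce w) f x = \prod_(x <- w) f x.
Proof.
move=> fV; apply: (reduce_invariant (f := fun w => \prod_(x <- w) f x)).
by move=> u x v; rewrite !big_cat !big_cons fV /= mulVKg.
Qed.

Lemma letter_prod g : g = \prod_(x <- letters g) letter x.
Proof.
apply: val_inj; rewrite /= -[LHS]reduce_id ?freeYP //.
elim: (letters g) => [|x w IHw]; first by rewrite big_nil.
by rewrite big_cons /= IHw reduce_id // freeYP.
Qed.

End FreeGroupEval.

(** * The quotient is a skew-brace *)

Section QuotientBrace.
Variable X : Type.
Local Notation Y := (Y X).
Local Notation quoG := (quoG X).
Implicit Types (x y : Y) (u v w : seq Y) (p q r : quoG).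

(** [pi_quo_mul] and [pi_quo_inv] mention the operations of the quotient before
    its group structure; rewriting with group laws requires these forms. *)
Lemma pi_mul : {morph \pi_quoG : g h / g * h}.
Proof. exact: pi_quo_mul. Qed.

Lemma pi_inv : {morph \pi_quoG : g / g^-1}.
Proof. exact: pi_quo_inv. Qed.

Definition quo_letter x : quoG := \pi_quoG (letter x).

Lemma quo_letter_star x : quo_letter (starY x) = (quo_letter x)^-1.
Proof. by rewrite /quo_letter letter_star pi_inv. Qed.

Lemma pi_letter_prod (g : freeY X) :
  \pi_quoG g = \prod_(x <- letters g) quo_letter x.
Proof.
by rewrite {1}[g]letter_prod (big_morph _ pi_mul (erefl _)).
Qed.

Lemma quo_letter_gen q : exists w, q = \prod_(x <- w) quo_letter x.
Proof. by elim/quotW: q => g; exists (letters g); apply: pi_letter_prod. Qed.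

Lemma quo_braided : braided (@starY X) quo_letter (@dotY X) (@colY X).
Proof.
split=> x y; [exact: dotYK | exact: colYK |].
rewrite /quo_letter -!pi_mul; apply/quoG_eqP; exact: sim_base.
Qed.

Lemma quo_letter_prod_reduce w :
  \prod_(x <- w) quo_letter x = \pi_quoG (Word (reduced_reduce w)).
Proof. by rewrite pi_letter_prod /= prod_reduce //; apply: quo_letter_star. Qed.

Lemma quo_dot_letter x w : quo_dot (quo_letter x) (\prod_(y <- w) quo_letter y) =
  word_act quo_letter (@dotY X) (@colY X) x (rev w).
Proof.
rewrite quo_letter_prod_reduce -pi_quo_dot /dotG /= /dot_letter /=.
transitivity (word_act quo_letter (@dotY X) (@colY X) x (rev (reduce w))).
  by elim: (rev _) x => //= y v IHv x; rewrite pi_mul IHv.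
apply: (reduce_invariant (f := fun w => word_act _ _ _ x (rev w))) => u z v.
rewrite !rev_cat !rev_cons !cat_rcons.
exact: word_act_cancel (@starYK X) quo_letter_star _ _ _ _ _ _ quo_braided.
Qed.

Lemma quo_col_letter x w : quo_col (quo_letter x) (\prod_(y <- w) quo_letter y) =
  word_act quo_letter (@colY X) (@dotY X) x (rev w).
Proof.
rewrite quo_letter_prod_reduce -pi_quo_col /colG /= /col_letter /=.
transitivity (word_act quo_letter (@colY X) (@dotY X) x (rev (reduce w))).
  by elim: (rev _) x => //= y v IHv x; rewrite pi_mul IHv.
apply: (reduce_invariant (f := fun w => word_act _ _ _ x (rev w))) => u z v.
rewrite !rev_cat !rev_cons !cat_rcons.
exact: word_act_cancel (@starYK X) quo_letter_star _ _ _ _ _ _ (braided_swap quo_braided).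
Qed.

(** The operation is defined by folding over a reduced word; the first hypothesis
    makes the fold insensitive to reduction, hence compatible with products. *)
Lemma quo_action (op : quoG -> quoG -> quoG) :
  (forall x q, op (quo_letter x)^-1 (op (quo_letter x) q) = q) ->
  (forall g q, op (\pi_quoG g) q =
     foldr (fun x => op (quo_letter x)) q (letters g)) ->
  is_left_action op.
Proof.
move=> opV opE.
have opP w q : op (\prod_(x <- w) quo_letter x) q =
    foldr (fun x => op (quo_letter x)) q w.
  rewrite quo_letter_prod_reduce opE /=.
  apply: (reduce_invariant (f := foldr _ q)) => u x v.
  rewrite !foldr_cat /= quo_letter_star.
  by rewrite -{1}[quo_letter x]invgK -quo_letter_star opV.
split=> [q|p q r]; first by have := opP [::] q; rewrite big_nil.
have [u ->] := quo_letter_gen p; have [v ->] := quo_letter_gen q.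
by rewrite -big_cat !opP foldr_cat.
Qed.

Lemma quo_lettered_actions :
  lettered_actions (@starY X) quo_letter (@dotY X) (@colY X)
    (@quo_dot X) (@quo_col X).
Proof.
have dr := word_act_letter_rule quo_letter_gen quo_dot_letter.
have cr := word_act_letter_rule quo_letter_gen quo_col_letter.
have inv := letter_rule_inv (@starYK X) quo_letter_star quo_letter_gen.
split=> //; [exact: quo_braided | |].
- apply: quo_action => [x q|g]; first exact: inv quo_braided dr.
  elim/quotW=> h; rewrite -pi_quo_dot /dotG; elim: (letters g) => //= x w <-.
  by rewrite -pi_quo_dot.
- apply: quo_action => [x q|g]; first exact: inv (braided_swap quo_braided) cr.
  elim/quotW=> h; rewrite -pi_quo_col /colG; elim: (letters g) => //= x w <-.
  by rewrite -pi_quo_col.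
Qed.

Lemma quo_skew_brace : is_skew_brace (@quo_dot X) (@quo_col X).
Proof. exact: lettered_skew_brace quo_letter_gen _ _ _ _ quo_lettered_actions. Qed.

End QuotientBrace.

(** * The universal property *)

Section Universal.
Variables (X : Type) (A : groupType) (dotA colA : A -> A -> A) (f : X -> A).
Hypothesis braceA : is_skew_brace dotA colA.
Local Notation Y := (Y X).
Local Notation quoG := (quoG X).
Implicit Types (x y : Y) (w : seq Y) (g h : freeY X) (a b t : symbol X).

Definition signed (s : bool) (a : A) : A := if s then a^-1 else a.

Fixpoint symbol_eval t : A :=
  match t with
  | Gen s x => signed s (f x)
  | Dot s a b => signed s (dotA (symbol_eval a) (symbol_eval b))
  | Col s a b => signed s (colA (symbol_eval a) (symbol_eval b))
  end.

Lemma symbol_eval_star t : symbol_eval (star_symbol t) = (symbol_eval t)^-1.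
Proof. by case: t => -[] * /=; rewrite ?invgK. Qed.

(** In the cancelling case b = a^*.c, this is the action law a.(a^-1.c) = c. *)
Lemma symbol_eval_dot a b :
  symbol_eval (dot_symbol a b) = dotA (symbol_eval a) (symbol_eval b).
Proof.
have [[c -> ->]|[_ -> //]] := dot_symbolP a b.
have [[dot1 dotM] _ _] := braceA.
by rewrite /= symbol_eval_star -dotM mulgV dot1.
Qed.

Lemma symbol_eval_col a b :
  symbol_eval (col_symbol a b) = colA (symbol_eval a) (symbol_eval b).
Proof.
have [[c -> ->]|[_ -> //]] := col_symbolP a b.
have [_ [col1 colM] _] := braceA.
by rewrite /= symbol_eval_star -colM mulgV col1.
Qed.

Definition free_eval g : A := \prod_(x <- letters g) symbol_eval (val x).

Lemma free_eval_letter x : free_eval (letter x) = symbol_eval (val x).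
Proof. exact: big_seq1. Qed.

Lemma free_evalM : {morph free_eval : g h / g * h}.
Proof.
move=> g h; rewrite /free_eval /= prod_reduce ?big_cat //.
by move=> x; rewrite -symbol_eval_star.
Qed.

Lemma free_eval1 : free_eval 1 = 1.
Proof. exact: big_nil. Qed.

(** The recursion on words is matched step by step by [skew_brace_dotM]. *)
Lemma free_eval_dot_letter x g :
  free_eval (dot_letter x g) = dotA (symbol_eval (val x)) (free_eval g).
Proof.
rewrite /dot_letter /free_eval -[in RHS](revK (letters g)).
elim: (rev g) x => [|y w IHw] x.
  by rewrite !big_nil (skew_brace_dot1 braceA).
rewrite -/(free_eval _) free_evalM {1}/free_eval IHw free_eval_letter.
rewrite rev_cons -cats1 big_cat big_seq1 (skew_brace_dotM braceA).
by rewrite symbol_eval_dot symbol_eval_col.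
Qed.

Lemma free_eval_col_letter x g :
  free_eval (col_letter x g) = colA (symbol_eval (val x)) (free_eval g).
Proof.
have braceA' := is_skew_brace_swap braceA.
rewrite /col_letter /free_eval -[in RHS](revK (letters g)).
elim: (rev g) x => [|y w IHw] x.
  by rewrite !big_nil (skew_brace_dot1 braceA').
rewrite -/(free_eval _) free_evalM {1}/free_eval IHw free_eval_letter.
rewrite rev_cons -cats1 big_cat big_seq1 (skew_brace_dotM braceA').
by rewrite symbol_eval_dot symbol_eval_col.
Qed.

Lemma free_eval_dot g h :
  free_eval (dotG g h) = dotA (free_eval g) (free_eval h).
Proof.
have [[dot1 dotM] _ _] := braceA.
rewrite /dotG {2}/free_eval; elim: (letters g) => [|x w IHw].
  by rewrite big_nil dot1.
by rewrite big_cons dotM -IHw -free_eval_dot_letter.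
Qed.

Lemma free_eval_col g h :
  free_eval (colG g h) = colA (free_eval g) (free_eval h).
Proof.
have [_ [col1 colM] _] := braceA.
rewrite /colG {2}/free_eval; elim: (letters g) => [|x w IHw].
  by rewrite big_nil col1.
by rewrite big_cons colM -IHw -free_eval_col_letter.
Qed.

Lemma free_eval_sim g h : sim g h -> free_eval g = free_eval h.
Proof.
elim=> {g h} // [g h k _ -> _ -> //|x y|a b c d _ ab _ cd|a b c d _ ab _ cd|
  a b c d _ ab _ cd].
- rewrite !free_evalM !free_eval_letter symbol_eval_dot symbol_eval_col.
  by case: braceA.
- by rewrite !free_evalM ab cd.
- by rewrite !free_eval_dot ab cd.
- by rewrite !free_eval_col ab cd.
Qed.

Definition quo_eval (q : quoG) : A := free_eval (repr q).

Lemma quo_eval_pi g : quo_eval (\pi_quoG g) = free_eval g.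
Proof. exact/free_eval_sim/sim_repr. Qed.

Lemma quo_eval_morphism :
  is_skew_brace_morphism (@quo_dot X) (@quo_col X) dotA colA quo_eval.
Proof.
split; first split.
- by rewrite quo_eval_pi free_eval1.
- elim/quotW=> g; elim/quotW=> h.
  by rewrite -pi_mul !quo_eval_pi free_evalM.
- elim/quotW=> g; elim/quotW=> h.
  by rewrite -pi_quo_dot !quo_eval_pi free_eval_dot.
- elim/quotW=> g; elim/quotW=> h.
  by rewrite -pi_quo_col !quo_eval_pi free_eval_col.
Qed.

Lemma quo_eval_gen (x : X) : quo_eval (quo_gen x) = f x.
Proof. by rewrite quo_eval_pi free_eval_letter. Qed.

(** Induction on the symbol: a letter of Y that is not a generator is, up to a
    star, the value of the letter operation at two smaller letters, since its
    formal symbol does not cancel ([Y_stage_Dot], [Y_stage_Col]). *)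
Lemma morphism_letter (phi : quoG -> A) :
  is_skew_brace_morphism (@quo_dot X) (@quo_col X) dotA colA phi ->
  (forall x : X, phi (quo_gen x) = f x) ->
  forall y, phi (quo_letter y) = symbol_eval (val y).
Proof.
case=> [[phi1 phiM] phi_dot phi_col] phi_gen.
have [_ dr cr _ _] := quo_lettered_actions X.
have phiV q : phi q^-1 = (phi q)^-1.
  by apply: (mulgI (phi q)); rewrite -phiM !mulgV.
have signedE s t (y z : Y) : val z = t -> phi (quo_letter z) = symbol_eval t ->
    val y = (if s then star_symbol t else t) ->
    phi (quo_letter y) = signed s (symbol_eval t).
  move=> zt phiz yE; have -> : y = (if s then starY z else z).
    by apply: val_inj; rewrite yE; case: (s); rewrite /= zt.
  by case: s {yE} => //=; rewrite quo_letter_star phiV phiz.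
have letterY n t : Y_stage n t -> exists z : Y, val z = t.
  by move=> Yt; exists (SigSub (mem_set (ex_intro2 _ _ n I Yt))).
move=> y; move yt: (val y) => t; elim: t y yt => [s x|s a IHa b IHb|s a IHa b IHb] y yt.
- apply: (signedE s (Gen false x) y (genY x)) => //; first exact: phi_gen.
  by rewrite yt; case: (s).
- have [n _] := set_mem (valP y); rewrite yt => /Y_stage_Dot[Ya Yb bN].
  have [za zaE] := letterY _ _ Ya.
  have [zb zbE] := letterY _ _ Yb.
  have zE : val (dotY za zb) = Dot false a b.
    by rewrite /= zaE zbE dot_symbol_formal.
  apply: (signedE s (Dot false a b) y (dotY za zb)) => //; last first.
    by rewrite yt; case: (s).
  by rewrite -(letter_rule_letter _ _ dr) phi_dot (IHa _ zaE) (IHb _ zbE).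
- have [n _] := set_mem (valP y); rewrite yt => /Y_stage_Col[Ya Yb bN].
  have [za zaE] := letterY _ _ Ya.
  have [zb zbE] := letterY _ _ Yb.
  have zE : val (colY za zb) = Col false a b.
    by rewrite /= zaE zbE col_symbol_formal.
  apply: (signedE s (Col false a b) y (colY za zb)) => //; last first.
    by rewrite yt; case: (s).
  by rewrite -(letter_rule_letter _ _ cr) phi_col (IHa _ zaE) (IHb _ zbE).
Qed.

Lemma quo_eval_unique (phi : quoG -> A) :
  is_skew_brace_morphism (@quo_dot X) (@quo_col X) dotA colA phi ->
  (forall x : X, phi (quo_gen x) = f x) -> phi =1 quo_eval.
Proof.
move=> morphi phi_gen; elim/quotW=> g; rewrite quo_eval_pi pi_letter_prod.
have [[phi1 phiM] _ _] := morphi.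
rewrite (big_morph _ phiM phi1).
by apply: eq_bigr => y _; apply: morphism_letter.
Qed.

End Universal.

Theorem theorem1p3 (X : Type) :
  is_skew_brace (@quo_dot X) (@quo_col X) /\
  (forall (A : groupType) (dotA colA : A -> A -> A),
     is_skew_brace dotA colA ->
     forall f : X -> A,
       exists! phi : quoG X -> A,
         is_skew_brace_morphism (@quo_dot X) (@quo_col X) dotA colA phi /\
         f = phi \o @quo_gen X).
Proof.
split; first exact: quo_skew_brace.
move=> A dotA colA braceA f; exists (quo_eval dotA colA f); split.
  split; first exact: quo_eval_morphism.
  by apply/funext => x; rewrite /= quo_eval_gen.
move=> phi [morphi fE]; apply/funext => q; apply/esym.
by apply: (quo_eval_unique braceA morphi) => x; rewrite fE.
Qed.
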